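(* For every integer $j\ge 0$, the following identity holds as formal power series in $q$: $$\sum_{m\ge j} \sum_{n\ge 0} M(m,n)\, q^n \;=\; \sum_{n\ge 0} \frac{q^{(n+1)(n+j)}}{(q;q)_n\, (q;q)_{n+j}}.$$
   Context: A partition of a positive integer $n$ is a finite weakly decreasing sequence of positive integers $\lambda=(\lambda_1\ge\lambda_2\ge\cdots\ge\lambda_r\ge 1)$ with sum $n$. Let $\omega(\lambda)$ be the number of parts of $\lambda$ equal to $1$ and $\mu(\lambda)$ the number of parts of $\lambda$ that are greater than $\omega(\lambda)$. The crank of $\lambda$ is $\mathrm{crank}(\lambda)=\lambda_1$ if $\omega(\lambda)=0$, and $\mathrm{crank}(\lambda)=\mu(\lambda)-\omega(\lambda)$ if $\omega(\lambda)>0$. For integers $m$ and $n>1$, $M(m,n)$ is the number of partitions of $n$ with crank $m$. For $n\in\{0,1\}$, by convention, $M(0,0)=1$, $M(1,1)=1$, $M(-1,1)=1$, $M(0,1)=-1$, and all other values $M(m,0)$, $M(m,1)$ are $0$. Notation: $(a;q)_n=(1-a)(1-aq)\cdots(1-aq^{n-1})$, with $(a;q)_0=1$. *)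

(* Defs.v *)
From HB Require Import structures.
From mathcomp Require Import all_boot all_order all_algebra.
From mathcomp Require Import boolp.

Set Implicit Arguments.
Unset Strict Implicit.
Unset Printing Implicit Defensive.

Import Order.TTheory GRing.Theory Num.Theory.
Local Open Scope ring_scope.

(* A wrapper rather than [nat -> R], on which MathComp-Analysis puts the pointwise
   product. *)
Record fps (R : Type) := Fps { fps_coef : nat -> R }.

Lemma fpsP (R : Type) (f g : fps R) :
  (forall n, fps_coef f n = fps_coef g n) -> f = g.
Proof. by case: f g => [f] [g] /= fg; congr Fps; apply/funext. Qed.

HB.instance Definition _ (R : Type) := gen_eqMixin (fps R).
HB.instance Definition _ (R : Type) := gen_choiceMixin (fps R).

Section FpsZmodule.
Variable R : zmodType.
Implicit Types f g h : fps R.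

Definition fps0 : fps R := Fps (fun=> 0).
Definition fps_opp f := Fps (fun n => - fps_coef f n).
Definition fps_add f g := Fps (fun n => fps_coef f n + fps_coef g n).

Fact fps_addA : associative fps_add.
Proof. by move=> f g h; apply: fpsP => n /=; rewrite addrA. Qed.
Fact fps_addC : commutative fps_add.
Proof. by move=> f g; apply: fpsP => n /=; rewrite addrC. Qed.
Fact fps_add0 : left_id fps0 fps_add.
Proof. by move=> f; apply: fpsP => n /=; rewrite add0r. Qed.
Fact fps_addN : left_inverse fps0 fps_opp fps_add.
Proof. by move=> f; apply: fpsP => n /=; rewrite addNr. Qed.

HB.instance Definition _ :=
  GRing.isZmodule.Build (fps R) fps_addA fps_addC fps_add0 fps_addN.

Lemma fps_coefD f g n : fps_coef (f + g) n = fps_coef f n + fps_coef g n.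
Proof. by []. Qed.

Lemma fps_coefB f g n : fps_coef (f - g) n = fps_coef f n - fps_coef g n.
Proof. by []. Qed.

End FpsZmodule.

Section FpsRing.
Variable R : comNzRingType.
Implicit Types f g h : fps R.

Definition fps1 : fps R := Fps (fun n => (n == 0%N)%:R).
Definition fps_mul f g :=
  Fps (fun n => \sum_(i < n.+1) fps_coef f i * fps_coef g (n - i)%N).

Definition fps_trunc N f : {poly R} := \poly_(i < N) fps_coef f i.

Lemma fps_coef_trunc N f n : (n < N)%N -> fps_coef f n = (fps_trunc N f)`_n.
Proof. by move=> ltnN; rewrite coef_poly ltnN. Qed.

Lemma fps_coef_mul N f g n : (n < N)%N ->
  fps_coef (fps_mul f g) n = (fps_trunc N f * fps_trunc N g)`_n.
Proof.
move=> ltnN; rewrite coefM; apply: eq_bigr => i _.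
have leiN : (i < N)%N by apply: leq_trans ltnN; rewrite ltn_ord.
by rewrite -!fps_coef_trunc // (leq_ltn_trans (leq_subr _ _)).
Qed.

Fact fps_mulC : commutative fps_mul.
Proof. by move=> f g; apply: fpsP => n; rewrite !(fps_coef_mul (N := n.+1)) // mulrC. Qed.

Fact fps_mulA : associative fps_mul.
Proof.
move=> f g h; apply: fpsP => n.
transitivity (fps_trunc n.+1 f * (fps_trunc n.+1 g * fps_trunc n.+1 h))`_n.
  rewrite coefM; apply: eq_bigr => i _.
  by rewrite -(fps_coef_trunc f (ltn_ord i)) (fps_coef_mul (N := n.+1)) // ltnS leq_subr.
rewrite mulrA coefM; apply/esym/eq_bigr => i _.
by rewrite (fps_coef_mul (N := n.+1)) // -fps_coef_trunc // ltnS leq_subr.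
Qed.

Fact fps_mul1 : left_id fps1 fps_mul.
Proof.
move=> f; apply: fpsP => n /=.
rewrite big_ord_recl /= mul1r subn0 big1 ?addr0 // => i _.
by rewrite mul0r.
Qed.

Fact fps_mulDl : left_distributive fps_mul (@fps_add R).
Proof.
move=> f g h; apply: fpsP => n /=; rewrite -big_split /=.
by apply: eq_bigr => i _; rewrite mulrDl.
Qed.

Fact fps1_neq0 : fps1 != 0 :> fps R.
Proof.
by apply/eqP => /(congr1 (fun f => fps_coef f 0)) /= /eqP; rewrite oner_eq0.
Qed.

HB.instance Definition _ := GRing.Zmodule_isComNzRing.Build (fps R)
  fps_mulA fps_mulC fps_mul1 fps_mulDl fps1_neq0.

Lemma fps_coef1 n : fps_coef (1 : fps R) n = (n == 0%N)%:R.
Proof. by []. Qed.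

Lemma fps_coefM f g n :
  fps_coef (f * g) n = \sum_(i < n.+1) fps_coef f i * fps_coef g (n - i)%N.
Proof. by []. Qed.

Lemma fps_coef0M f g : fps_coef (f * g) 0 = fps_coef f 0 * fps_coef g 0.
Proof. by rewrite fps_coefM big_ord1. Qed.

Definition fpsX : fps R := Fps (fun n => (n == 1%N)%:R).

End FpsRing.

Arguments fpsX {R}.

Section FpsUnitRing.
Variable R : comUnitRingType.
Implicit Types f g h : fps R.

Definition fps_unit : pred (fps R) := fun f => fps_coef f 0 \is a GRing.unit.

(* The coefficient g_n of the inverse g of f, from s = [:: g_0; ...; g_(n-1)]:
   g_n f_0 = [n = 0] - \sum_(i < n) g_i f_(n-i). *)
Definition fps_inv_next f (s : seq R) : R :=
  ((size s == 0%N)%:R - \sum_(i < size s) s`_i * fps_coef f (size s - i)%N)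
    / fps_coef f 0.
Definition fps_inv_seq f n : seq R :=
  iter n (fun s => rcons s (fps_inv_next f s)) [::].
Definition fps_inv f : fps R :=
  if fps_unit f then Fps (fun n => fps_inv_next f (fps_inv_seq f n)) else f.

Lemma size_fps_inv_seq f n : size (fps_inv_seq f n) = n.
Proof. by elim: n => //= n IHn; rewrite size_rcons IHn. Qed.

Lemma nth_fps_inv_seq f n i : (i < n)%N ->
  (fps_inv_seq f n)`_i = fps_inv_next f (fps_inv_seq f i).
Proof.
elim: n => // n IHn; rewrite ltnS leq_eqVlt /= nth_rcons size_fps_inv_seq.
by case/predU1P=> [->|ltin]; rewrite ?ltnn ?eqxx // ltin IHn.
Qed.

Fact fps_mulVx : {in fps_unit, left_inverse 1 fps_inv *%R}.
Proof.
move=> f fU; have Uf : fps_unit f := fU; apply: fpsP => n.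
rewrite /fps_inv Uf fps_coefM /= big_ord_recr /= subnn.
rewrite [X in _ + X * _]/fps_inv_next divrK // size_fps_inv_seq addrC.
rewrite [X in _ - _ + X](_ : _ = \sum_(i < n)
  (fps_inv_seq f n)`_i * fps_coef f (n - i)%N) ?subrK //.
by apply: eq_bigr => i _; rewrite nth_fps_inv_seq.
Qed.

Fact fps_unitPl f g : g * f = 1 -> fps_unit f.
Proof.
move=> /(congr1 (fun h => fps_coef h 0)); rewrite fps_coef0M => gf1.
by apply/unitrPr; exists (fps_coef g 0); rewrite mulrC.
Qed.

Fact fps_inv_out : {in [predC fps_unit], fps_inv =1 id}.
Proof. by move=> f fN; have /negPf Nf : ~~ fps_unit f := fN; rewrite /fps_inv Nf. Qed.

HB.instance Definition _ := GRing.ComNzRing_hasMulInverse.Build (fps R)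
  fps_mulVx fps_unitPl fps_inv_out.

Lemma fps_unitE f : (f \is a GRing.unit) = (fps_coef f 0 \is a GRing.unit).
Proof. by []. Qed.

End FpsUnitRing.

(* [fps_has_sum F S]: the series \sum_(k >= 0) F k converges to S coefficient
   by coefficient, each coefficient of the partial sums being eventually
   constant. *)
Definition fps_has_sum (R : nmodType) (F : nat -> fps R) (S : fps R) : Prop :=
  forall n, exists K, forall k, (K <= k)%N ->
    \sum_(i < k) fps_coef (F i) n = fps_coef S n.

Lemma fps_has_sum_unique (R : nmodType) (F : nat -> fps R) (S T : fps R) :
  fps_has_sum F S -> fps_has_sum F T -> S = T.
Proof.
move=> FS FT; apply: fpsP => n; have [[K FSn] [L FTn]] := (FS n, FT n).
by rewrite -(FSn (maxn K L)) ?leq_maxl // FTn // leq_maxr.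
Qed.

(* (a; q)_n with q the variable of the power series ring. *)
Definition qpoch (R : comNzRingType) (a : fps R) (n : nat) : fps R :=
  \prod_(i < n) (1 - a * fpsX ^+ i).

Lemma qpoch_unit (R : comUnitRingType) n :
  qpoch (fpsX : fps R) n \is a GRing.unit.
Proof.
apply: rpred_prod => i _.
by rewrite fps_unitE fps_coefB fps_coef0M mul0r subr0 unitr1.
Qed.

Definition is_intpart (n : nat) (s : seq nat) : bool :=
  [&& sorted geq s, all (leq 1%N) s & sumn s == n].

Record intpart (n : nat) :=
  IntPart { parts :> seq nat; _ : is_intpart n parts }.

HB.instance Definition _ n := [isSub for @parts n].
HB.instance Definition _ n := [Countable of intpart n by <:].

Section IntPartFinite.
Variable n : nat.

Lemma intpart_size (l : intpart n) : (size l <= n)%N.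
Proof.
case: l => s /= /and3P[_ s_gt0 /eqP <-].
by elim: s s_gt0 => //= x s IHs /andP[x_gt0 /IHs]; rewrite -add1n; apply: leq_add.
Qed.

Lemma intpart_le (l : intpart n) x : x \in (l : seq nat) -> (x <= n)%N.
Proof.
case: l => s /= /and3P[_ _ /eqP <-]; elim: s => //= y s IHs.
rewrite inE => /predU1P[->|/IHs xs]; first exact: leq_addr.
exact: leq_trans xs (leq_addl _ _).
Qed.

(* Finiteness: a partition of n has at most n parts, all of them at most n. *)
Definition intpart_code (l : intpart n) : n.-bseq 'I_n.+1 :=
  insub_bseq n (map inord l).
Definition intpart_decode (t : n.-bseq 'I_n.+1) : option (intpart n) :=
  insub (map val t).

Fact intpart_codeK : pcancel intpart_code intpart_decode.
Proof.
move=> l; rewrite /intpart_decode -[RHS]valK; congr insub.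
rewrite /intpart_code insubdK ?unfold_in ?size_map ?intpart_size //.
rewrite -map_comp map_id_in // => x /intpart_le lexn.
by rewrite /= inordK.
Qed.

HB.instance Definition _ : isFinite (intpart n) := PCanIsFinite intpart_codeK.

End IntPartFinite.

Definition ones (s : seq nat) : nat := count_mem 1%N s.
Definition mu (s : seq nat) : nat := count (ltn (ones s)) s.
(* The largest part is the head, as partitions are weakly decreasing. *)
Definition crank (s : seq nat) : int :=
  if ones s == 0%N then (head 0%N s)%:Z else (mu s)%:Z - (ones s)%:Z.

(* M(m, n); the values at n = 0, 1 are conventions, not counts. *)
Definition crankM (m : int) (n : nat) : int :=
  match n with
  | 0%N => (m == 0)%:R
  | 1%N => if m == 0 then -1 else ((m == 1) || (m == -1))%:R
  | _ => #|[set l : intpart n | crank l == m]|%:Z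
  end.

(* Main.v *)
(** Sorting partitions by their number [w] of ones, those with crank [m >= 0] and [w > 0]
    have exactly [w + m] parts larger than [w], hence generating function
    T(m,w) = (1-q) q^(w + (w+1)(w+m)) / ((q)_w (q)_(w+m)).
    Together with the conventions for n = 0, 1, the partitions without ones give T(m,0).
    Writing U(j,i) for the i-th term of the right-hand side, one has
    U(j,i) - U(j+1,i) - T(j,i) = V(i) - V(i+1) with V(i) = (1-q^i) U(j,i) and V(0) = 0,
    so the right-hand sides for j and j+1 differ by the series of crank j; the one for j + k
    tends to 0 as k grows. *)
Require Import Defs.
From HB Require Import structures.
From mathcomp Require Import all_boot all_order all_algebra.
From mathcomp Require Import zify ring.
Import GRing.Theory.
Local Open Scope ring_scope.

(** * Power series and q-Pochhammer preliminaries *)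

Lemma fps_coefXnM (R : comNzRingType) (f : fps R) d n :
  fps_coef (fpsX ^+ d * f) n = if (n < d)%N then 0 else fps_coef f (n - d).
Proof.
elim: d n => [|d IHd] n; first by rewrite expr0 mul1r subn0.
have XM (g : fps R) k : fps_coef (fpsX * g) k = if k is k'.+1 then fps_coef g k' else 0.
  rewrite fps_coefM; case: k => [|k]; first by rewrite big_ord1 mul0r.
  rewrite big_ord_recl mul0r add0r big_ord_recl mul1r /= subSS subn0.
  by rewrite big1 ?addr0 // => i _; rewrite mul0r.
by rewrite exprS -mulrA XM; case: n => // n; rewrite IHd ltnS subSS.
Qed.

Lemma fps_coef_sum (R : comNzRingType) (I : Type) (r : seq I) (F : I -> fps R) n :
  fps_coef (\sum_(i <- r) F i) n = \sum_(i <- r) fps_coef (F i) n.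
Proof. by elim/big_rec2: _ => // i x y _ <-. Qed.

Lemma qpochS (R : comNzRingType) n :
  qpoch (fpsX : fps R) n.+1 = qpoch fpsX n * (1 - fpsX ^+ n.+1).
Proof. by rewrite /qpoch big_ord_recr /= -exprS. Qed.

Lemma qpoch1 (R : comNzRingType) : qpoch (fpsX : fps R) 1 = 1 - fpsX.
Proof. by rewrite /qpoch big_ord1 expr0 mulr1. Qed.

Lemma one_subX_unit (R : comUnitRingType) n :
  (1 - fpsX ^+ n.+1 : fps R) \is a GRing.unit.
Proof. by rewrite fps_unitE fps_coefB exprS fps_coef0M mul0r subr0 unitr1. Qed.

Lemma qpochSV (R : comUnitRingType) n :
  (qpoch (fpsX : fps R) n)^-1 = (qpoch fpsX n.+1)^-1 * (1 - fpsX ^+ n.+1).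
Proof. by rewrite qpochS invrM ?qpoch_unit ?one_subX_unit // mulrAC mulVr ?one_subX_unit // mul1r. Qed.

(** * Generating functions of classes of partitions *)

Definition ispart (s : seq nat) := sorted geq s && all (leq 1%N) s.

(** Partitions become plain sequences, so that one predicate or one map serves all sizes [n] at
    once. *)
Definition intparts n : seq (seq nat) := [seq val l | l <- enum {: intpart n}].

Lemma intparts_uniq n : uniq (intparts n).
Proof. by rewrite map_inj_uniq ?enum_uniq //; apply: val_inj. Qed.

Lemma mem_intparts n s : (s \in intparts n) = ispart s && (sumn s == n).
Proof.
rewrite -andbA -[RHS]/(is_intpart n s); apply/mapP/idP => [[l _ ->]|sP].
  exact: (valP l).
by exists (IntPart sP); rewrite ?mem_enum.
Qed.

Lemma card_intpart n (P : pred (seq nat)) :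
  #|[set l : intpart n | P l]| = count P (intparts n).
Proof. by rewrite cardsE cardE count_map -size_filter enumT. Qed.

Definition pgf (P : pred (seq nat)) : fps int :=
  Fps (fun n => (count P (intparts n))%:Z).

Lemma eq_pgf (P Q : pred (seq nat)) :
  (forall s, ispart s -> P s = Q s) -> pgf P = pgf Q.
Proof.
move=> PQ; apply: fpsP => n /=; congr Posz; apply: eq_in_count => s.
by rewrite mem_intparts => /andP[/PQ].
Qed.

Lemma pgf_eq0 (P : pred (seq nat)) : (forall s, ispart s -> ~~ P s) -> pgf P = 0.
Proof.
move=> P0; apply: fpsP => n /=; rewrite -[RHS]/(Posz 0) -(count_pred0 (intparts n)).
congr Posz; by apply: eq_in_count => s; rewrite mem_intparts => /andP[/P0/negbTE].
Qed.

Lemma pgf_split (Q P : pred (seq nat)) :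
  pgf P = pgf (predI P (predC Q)) + pgf (predI P Q).
Proof.
apply: fpsP => n; rewrite /= -PoszD; congr Posz.
elim: (intparts n) => //= s r ->.
by case: (P s) (Q s) => [] [] /=; lia.
Qed.

(** Serves for three maps: appending a smallest part, prepending a largest part, and adding 1 to
    every part. *)
Lemma pgf_bij (f : seq nat -> seq nat) d (P Q : pred (seq nat)) :
    injective f ->
    (forall s, ispart s -> P s -> [/\ ispart (f s), Q (f s) & sumn (f s) = (sumn s + d)%N]) ->
    (forall t, ispart t -> Q t -> exists s, [/\ ispart s, P s & t = f s]) ->
  pgf Q = fpsX ^+ d * pgf P.
Proof.
move=> f_inj fP fQ; apply: fpsP => n; rewrite fps_coefXnM /=.
have [ltnd|ledn] := ltnP n d.
  rewrite -[RHS]/(Posz 0) -(count_pred0 (intparts n)); congr Posz; apply: eq_in_count => t.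
  rewrite mem_intparts => /andP[t_part /eqP tn]; apply/negP => /(fQ _ t_part)[s [sp Ps et]].
  by case: (fP _ sp Ps) => _ _; rewrite -et; lia.
congr Posz; rewrite -!size_filter -[RHS](size_map f).
apply/perm_size/uniq_perm; rewrite ?map_inj_uniq ?filter_uniq ?intparts_uniq //.
move=> t; rewrite mem_filter mem_intparts; apply/idP/mapP => [|[s]].
  case/and3P=> Qt t_part /eqP tn; have [s [sp Ps et]] := fQ _ t_part Qt.
  exists s => //; case: (fP _ sp Ps) => _ _; rewrite -et mem_filter mem_intparts Ps sp /= => ?.
  by apply/eqP; lia.
rewrite mem_filter mem_intparts => /and3P[Ps sp /eqP sn] ->.
by have [-> -> ->] := fP _ sp Ps; apply/eqP; lia.
Qed.

Lemma ispart_rcons s x :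
  ispart (rcons s x) = [&& ispart s, all (leq x) s & (0 < x)%N].
Proof.
rewrite /ispart !(sorted_pairwise (rev_trans leq_trans)) pairwise_rcons all_rcons.
by rewrite andbA; do !case: (all _ _); case: (pairwise _ _); case: (0 < x)%N.
Qed.

(** * Partitions with parts bounded below *)

Definition pge i (Q : pred (seq nat)) : pred (seq nat) :=
  fun s => all (leq i) s && Q s.

(* Partitions into parts [>= i] either have no part [i], or end with it. *)
Lemma pgf_rcons i (Q : pred (seq nat)) : (0 < i)%N ->
  pgf (pge i Q) = pgf (pge i.+1 Q) + fpsX ^+ i * pgf (pge i (fun s => Q (rcons s i))).
Proof.
move=> i_gt0; rewrite (pgf_split (fun s => i \in s)); congr (_ + _).
  apply: eq_pgf => s _; rewrite /pge /= andbAC; congr (_ && _).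
  elim: s => //= x s; rewrite inE; case: (i \in s); case: (all (leq i) s); case: (all _ s) => //=;
    by move=> ?; apply/idP/idP; lia.
apply: (pgf_bij (fun s => rcons s i)) => [s t /rcons_inj[]|s sp /andP[si Qs]|t] //.
  rewrite ispart_rcons sp si i_gt0 /pge /= all_rcons leqnn si Qs mem_rcons mem_head.
  by split => //; rewrite -cats1 sumn_cat /= addn0.
case/lastP: t => [|s x]; first by rewrite /pge /= andbF.
rewrite ispart_rcons /pge /= all_rcons => /and3P[sp sx x0] /andP[/andP[/andP[ix si]]].
rewrite mem_rcons inE => Qs /predU1P xi.
have {}xi : x = i.
  by case: xi => // /(allP sx) xi; apply/eqP; rewrite eqn_leq ix xi.
by exists s; rewrite si xi -{1}xi Qs.
Qed.

Lemma pgf_pge_invariant i (Q : pred (seq nat)) : (0 < i)%N ->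
    (forall s, Q (rcons s i) = Q s) ->
  pgf (pge i Q) * (1 - fpsX ^+ i) = pgf (pge i.+1 Q).
Proof.
move=> i_gt0 Qi; rewrite mulrBr mulr1 {1}pgf_rcons //.
rewrite (_ : pgf (pge i (fun s => _)) = pgf (pge i Q)); first by ring.
by apply: eq_pgf => s _; rewrite /pge Qi.
Qed.

(** The parts 2, ..., k occur freely and contribute 1/((1-q^2)...(1-q^k)) = (1-q)/(q)_k. *)
Lemma pgf_pge2 k (Q : pred (seq nat)) : (0 < k)%N ->
    (forall i s, (0 < i <= k)%N -> Q (rcons s i) = Q s) ->
  pgf (pge 2 Q) * qpoch fpsX k = (1 - fpsX) * pgf (pge k.+1 Q).
Proof.
elim: k => // -[_ _ _|k IHk _ Qk]; first by rewrite qpoch1 mulrC.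
rewrite qpochS mulrA IHk // => [|i s /andP[? ?]]; last by apply: Qk; lia.
by rewrite -mulrA pgf_pge_invariant // => s; apply: Qk; lia.
Qed.

Lemma pgf_nil (P : pred (seq nat)) :
  (forall s, ispart s -> P s = nilp s) -> pgf P = 1.
Proof.
move=> Pnil; apply: fpsP => n /=; rewrite -[RHS]/((n == 0%N)%:R).
transitivity (([::] \in intparts n)%:Z); last by rewrite mem_intparts /= eq_sym; case: eqP.
rewrite -count_uniq_mem ?intparts_uniq //; congr Posz; apply: eq_in_count => s.
by rewrite mem_intparts => /andP[/Pnil-> _]; case: s.
Qed.

Lemma pgf_size_shift i a :
  pgf (pge i.+2 (fun s => size s == a)) = fpsX ^+ a * pgf (pge i.+1 (fun s => size s == a)).
Proof.
have sorted_S s : sorted geq (map S s) = sorted geq s by rewrite sorted_map.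
have sumn_S s : sumn (map S s) = (sumn s + size s)%N by elim: s => //= x s ->; lia.
apply: (pgf_bij (map S)) => [|s /andP[s_sorted _] /andP[si /eqP sa]|t /andP[t_sorted _] /andP[ti ta]].
- by apply: inj_map => x y [].
- rewrite /ispart /pge sorted_S s_sorted !all_map size_map sa eqxx sumn_S sa andbT.
  by split => //; apply/allP => x /(allP si).
have et : t = map S (map predn t).
  by rewrite -map_comp map_id_in // => x /(allP ti) /=; lia.
exists (map predn t); split => //.
  rewrite /ispart -sorted_S -et t_sorted all_map; apply/allP => x /(allP ti) /=; lia.
by rewrite /pge size_map ta all_map andbT; apply/allP => x /(allP ti) /=; lia.
Qed.

(** Let H_a be the series on the left. If the part i+1 is absent, subtracting 1 from every part
    gives q^a H_a; otherwise one copy is removed. Hence H_(a+1) = q^(a+1) H_(a+1) + q^(i+1) H_a. *)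
Lemma pgf_size i a :
  pgf (pge i.+1 (fun s => size s == a)) * qpoch fpsX a = fpsX ^+ (i.+1 * a).
Proof.
elim: a => [|a IHa].
  rewrite /qpoch big_ord0 mulr1 muln0; apply: pgf_nil => s _.
  by case: s => //= x s; rewrite /pge andbF.
have := pgf_rcons i.+1 (fun s => size s == a.+1) isT.
rewrite pgf_size_shift (_ : pgf (pge i.+1 (fun s => size (rcons s _) == _)) = pgf (pge i.+1 (fun s => size s == a))).
  move=> rec; rewrite qpochS mulnS exprD -IHa.
  set H := pgf _ in rec *; set q := fpsX ^+ a.+1 in rec *.
  by rewrite (_ : _ * (_ * _) = (H - q * H) * qpoch fpsX a); [rewrite {1}rec|]; ring.
by apply: eq_pgf => s _; rewrite /pge size_rcons eqSS.
Qed.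

(** * Partitions with given crank and number of ones *)

Lemma pgf_ones w v a :
  pgf (fun s => (ones s == v) && (count (ltn w.+1) s == a)) =
  fpsX ^+ v * pgf (pge 2 (fun s => count (ltn w.+1) s == a)).
Proof.
have ones0 s : ispart s -> (ones s == 0%N) = all (leq 2) s.
  case/andP=> _; rewrite /ones; elim: s => //= x s IHs /andP[x0 /IHs {}IHs].
  by rewrite -IHs; apply/idP/idP; lia.
(* The threshold [w.+1] is independent of [v], so it stays fixed while the ones are stripped one by
   one. *)
elim: v => [|v IHv].
  by rewrite expr0 mul1r; apply: eq_pgf => s sp; rewrite ones0.
rewrite exprS -mulrA -{}IHv.
set Q := fun s => _; transitivity (pgf (pge 1 Q)).
  by apply: eq_pgf => s /andP[_ s1]; rewrite /pge s1.
rewrite pgf_rcons // pgf_eq0 => [|s sp]; last first.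
  by rewrite /pge -ones0 // /Q; case: eqP => //= ->.
rewrite add0r; congr (_ * _); apply: eq_pgf => s /andP[_ s1].
by rewrite /pge s1 /Q /ones -cats1 !count_cat /= addn1 eqSS !addn0.
Qed.

Definition crank_term m w : fps int :=
  (1 - fpsX) * fpsX ^+ (w + w.+1 * (w + m)) / (qpoch fpsX w * qpoch fpsX (w + m)).

(** With W = [w.+1] ones, crank m means W+m parts above W. The ones give q^W, the parts 2, ..., W
    give (1-q)/(q)_W, and the W+m large parts give q^((W+1)(W+m))/(q)_(W+m). *)
Lemma pgf_crank_ones m w :
  pgf (fun s => (ones s == w.+1) && (crank s == m%:Z)) = crank_term m w.+1.
Proof.
transitivity (pgf (fun s => (ones s == w.+1) && (count (ltn w.+1) s == w.+1 + m)%N)).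
  apply: eq_pgf => s _; rewrite /crank /mu; case: eqP => //= ->.
  by apply/eqP/eqP; lia.
rewrite pgf_ones; set a := (w.+1 + m)%N; set Q := fun s => _.
have inv i s : (0 < i <= w.+1)%N -> Q (rcons s i) = Q s.
  by rewrite /Q -cats1 count_cat /= => ?; rewrite (_ : (_ < i)%N = false) ?addn0 //; lia.
have := pgf_pge2 w.+1 Q isT inv.
(* Once all parts exceed [w.+1], counting the large parts is counting all parts. *)
rewrite (_ : pgf (pge w.+2 Q) = pgf (pge w.+2 (fun s => size s == a))); last first.
  by apply: eq_pgf => s _; rewrite /pge; apply: andb_id2l; rewrite all_count /Q => /eqP->.
have := pgf_size w.+1 a => HP KH.
apply: (mulIr (qpoch_unit int w.+1)); apply: (mulIr (qpoch_unit int a)).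
rewrite /crank_term -[RHS]mulrA divrK ?unitrM ?qpoch_unit //.
by rewrite -(mulrA (fpsX ^+ _)) KH exprD -HP; ring.
Qed.

(** The crank is the largest part here. Only the empty partition has m = 0 and none has m = 1,
    whereas T(0,0) = 1-q and T(1,0) = q; this explains the correction. For m >= 2 the formula is
    exact. *)
Lemma pgf_crank_no_ones m :
  pgf (fun s => (ones s == 0%N) && (crank s == m%:Z)) =
  crank_term m 0 - ((m == 1%N)%:R - (m == 0%N)%:R) * fpsX.
Proof.
have crank0 s : (ones s == 0%N) && (crank s == m%:Z) = (ones s == 0%N) && (head 0%N s == m).
  by rewrite /crank; case: (ones s == 0%N).
case: m crank0 => [|[|m]] crank0; rewrite /crank_term add0n mul1n {1}/qpoch big_ord0 mul1r.
- rewrite /qpoch big_ord0 expr0 divr1 (pgf_nil _ _); first by rewrite /=; ring.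
  move=> s /andP[_ s1]; rewrite crank0; case: s s1 => //= x s /andP[x0 _].
  by apply/negP => /andP[_ /eqP]; lia.
- rewrite qpoch1 mulrAC divrr ?(one_subX_unit _ 0) // pgf_eq0; first by rewrite /=; ring.
  move=> s sp; rewrite crank0; case: s sp => [|x s] _ //; rewrite /ones /=.
  by apply/negP => /andP[/eqP+ /eqP]; case: eqP => //; lia.
(* Removing the largest part leaves a partition into parts between 2 and [m.+2]. *)
transitivity (fpsX ^+ m.+2 * pgf (pge 2 (all (leq^~ m.+2)))).
  apply: (pgf_bij (cons m.+2)) => [s t []|s|t] //.
    case/andP=> s_sorted s1 /andP[s2 sm]; rewrite crank0 /= eqxx andbT /ispart /=; split.
    - by rewrite (path_sortedE (rev_trans leq_trans)) sm s_sorted s1.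
    - rewrite /ones /= add0n; apply/eqP/count_memPn/negP => /(allP s2); lia.
    - by rewrite addnC.
  case: t => [|x t]; rewrite crank0 ?andbF // /ispart /=.
  rewrite (path_sortedE (rev_trans leq_trans)) => /andP[/andP[tx t_sorted] /andP[x0 t1]].
  case/andP=> to /eqP ex; rewrite -ex in to *.
  exists t; split => //; first by rewrite t_sorted.
  apply/andP; split => //; apply/allP => y yt; have := allP t1 y yt.
  case: y yt => [|[|y]] // yt _; move: to; rewrite /ones /= addn_eq0 => /andP[_ /eqP].
  by move/count_memPn; rewrite yt.
apply: (mulIr (qpoch_unit int m.+2)); rewrite subrr mul0r subr0 divrK ?qpoch_unit //.
rewrite -mulrA pgf_pge2 // => [|i s ?]; last first.
  by rewrite all_rcons (_ : (i <= m.+2)%N) //; lia.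
(* No part is both above [m.+2] and at most [m.+2], so only the empty partition remains. *)
rewrite pgf_nil ?mulr1 1?mulrC // => s _; rewrite /pge; case: s => //= x s.
by apply/negP => /andP[/andP[mx _] /andP[xm _]]; lia.
Qed.

(** * Summation over the number of ones *)

Lemma pgf_sum_ones (P : pred (seq nat)) n N : (n < N)%N ->
  fps_coef (pgf P) n =
  \sum_(w < N) fps_coef (pgf (fun s => (ones s == w) && P s)) n.
Proof.
move=> ltnN; have count_lt k : (count (fun s => (ones s < k)%N && P s) (intparts n))%:Z =
    \sum_(w < k) fps_coef (pgf (fun s => (ones s == w) && P s)) n.
  elim: k => [|k IHk]; first by rewrite big_ord0 (eq_count (a2 := pred0)) ?count_pred0.
  rewrite big_ord_recr -IHk /= -PoszD; congr Posz.
  elim: (intparts n) => //= s r ->.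
  by rewrite ltnS leq_eqVlt; case: (ltngtP (ones s) k) => //=; lia.
rewrite -count_lt /=; congr Posz; apply: eq_in_count => s.
rewrite mem_intparts => /andP[_ /eqP sn].
(* A partition of [n] has at most [n] ones, so the range [w < N] misses none. *)
rewrite (leq_ltn_trans _ ltnN) // -sn /ones; elim: s {sn} => //= x s IHs.
by case: eqP => [->|_]; lia.
Qed.

(* The corrections are the values M(0,1) = -1 and M(1,1) = 1, not counted by partitions. *)
Lemma crankM_pgf (m n : nat) :
  crankM m%:Z n =
  fps_coef (pgf (fun s => crank s == m%:Z) + ((m == 1%N)%:R - (m == 0%N)%:R) * fpsX) n.
Proof.
have intparts1 k s0 : ispart s0 -> sumn s0 = k ->
    (forall s, ispart s -> sumn s = k -> s = s0) -> intparts k = [:: s0].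
  move=> s0p s0k all_s0; apply: perm_small_eq => //; apply: uniq_perm => // [|s].
    exact: intparts_uniq.
  rewrite mem_intparts inE; apply/andP/eqP => [[sp /eqP/(all_s0 _ sp)]|->] //.
  by rewrite s0k.
have -> : ((m == 1%N)%:R - (m == 0%N)%:R) * fpsX =
    Fps (fun k => (k == 1%N)%:R * ((m == 1%N)%:R - (m == 0%N)%:R)) :> fps int.
  apply: fpsP => k; rewrite mulrC -[fpsX]expr1 fps_coefXnM /=.
  by case: k m => [|[|k]] [|[|m]].
case: n => [|[|n]]; rewrite fps_coefD /=.
(* The default value of [head] gives the empty partition crank 0, in agreement with M(0,0) = 1. *)
- rewrite (intparts1 0%N [::]) //= => [|s /andP[_ s1]].
    by rewrite addn0 mul0r addr0; case: m.
  by case: s s1 => //= x s /andP[x0 _]; lia.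
(* The partition [[:: 1]] has crank -1, so for m >= 0 the correction alone gives M(m,1). *)
- rewrite (intparts1 1%N [:: 1%N]) //= => [|s /andP[_ s1]].
    by rewrite addn0 mul1r; case: m => [|[|m]].
  case: s s1 => //= x [|y s] /= /andP[x0]; first by rewrite addn0 => _ ->.
  by case/andP; lia.
rewrite mul0r addr0; congr Posz.
exact: (card_intpart _ (fun s => crank s == m%:Z)).
Qed.

(** The corrections in [crankM_pgf] and [pgf_crank_no_ones] cancel. *)
Lemma crankM_sum (m n N : nat) : (n < N)%N ->
  crankM m%:Z n = \sum_(w < N) fps_coef (crank_term m w) n.
Proof.
case: N => // N ltnN; rewrite crankM_pgf fps_coefD (pgf_sum_ones _ _ _ ltnN).
rewrite !big_ord_recl addrAC -fps_coefD; congr (_ + _).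
  by rewrite [pgf _]pgf_crank_no_ones subrK.
by apply: eq_bigr => w _; rewrite [pgf _]pgf_crank_ones.
Qed.

(** * Telescoping the right-hand side *)

Definition tail_term j i : fps int :=
  fpsX ^+ (i.+1 * (i + j)) / (qpoch fpsX i * qpoch fpsX (i + j)).

Lemma tail_term_coef0 j i n : (n < i.+1 * (i + j))%N -> fps_coef (tail_term j i) n = 0.
Proof. by move=> lt; rewrite fps_coefXnM lt. Qed.

Lemma tail_term_telescope j i :
  tail_term j i - tail_term j.+1 i - crank_term j i =
  tail_term j i * (1 - fpsX ^+ i) - tail_term j i.+1 * (1 - fpsX ^+ i.+1).
Proof.
rewrite /tail_term /crank_term !invrM ?qpoch_unit // addSn addnS.
(* Over the common denominator (q)_(i+1) (q)_(i+j+1), the claim is a polynomial identity in q, q^i,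
   q^j and q^(i(i+j)). *)
rewrite (qpochSV _ (i + j)) (qpochSV _ i).
rewrite !mulSn !mulnS !(exprD, exprS).
move: (qpoch _ i.+1)^-1 (qpoch _ _)^-1 (fpsX ^+ (i * _)) (fpsX ^+ i) (fpsX ^+ j) => a b E u v.
ring.
Qed.

Lemma tail_sum_diff j n N : (n < N)%N ->
  \sum_(i < N) fps_coef (tail_term j i) n - \sum_(i < N) fps_coef (tail_term j.+1 i) n =
  crankM j%:Z n.
Proof.
move=> ltnN; rewrite (crankM_sum _ _ _ ltnN); apply/eqP; rewrite -subr_eq0 -!sumrB.
pose V i := tail_term j i * (1 - fpsX ^+ i).
have -> : \sum_(i < N) (fps_coef (tail_term j i) n - fps_coef (tail_term j.+1 i) n
    - fps_coef (crank_term j i) n) = fps_coef (V 0%N) n - fps_coef (V N) n.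
  rewrite -fps_coefB -opprB -telescope_sumr // big_mkord -sumrN fps_coef_sum.
  by apply: eq_bigr => i _; rewrite -!fps_coefB tail_term_telescope opprB.
(* V(0) = 0, and V(N) is divisible by q^((N+1)(N+j)), so its coefficient in degree [n < N]
   vanishes. *)
rewrite /V expr0 subrr mulr0 sub0r oppr_eq0 /tail_term -mulrA fps_coefXnM ifT //.
by rewrite (leq_trans ltnN) // mulSn; lia.
Qed.

Theorem theorem2p1 :
  forall j : nat, exists S : fps int,
    fps_has_sum (fun k => Fps (fun n => crankM (j + k)%N%:Z n)) S /\
    fps_has_sum (fun n => fpsX ^+ (n.+1 * (n + j))
                          / (qpoch fpsX n * qpoch fpsX (n + j))) S.
Proof.
(* Terms with i > n start in degree (i+1)(i+j) > n, so [n.+1] terms determine the coefficient of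
   q^n. *)
move=> j; exists (Fps (fun n => \sum_(i < n.+1) fps_coef (tail_term j i) n)).
split=> n; exists n.+1 => k ltnk /=.
  pose S k := \sum_(i < n.+1) fps_coef (tail_term (j + k) i) n.
  (* Each crank value j+k' is the difference of consecutive right-hand sides, so the sum over k' < k
     telescopes. *)
  transitivity (S 0%N - S k).
    rewrite -opprB -telescope_sumr // big_mkord -sumrN.
    by apply: eq_bigr => i _; rewrite opprB /S addnS tail_sum_diff.
  (* For k > n every exponent (i+1)(i+j+k) exceeds n, so [S k] vanishes. *)
  rewrite /S addn0 [X in _ - X]big1 ?subr0 // => i _.
  by rewrite tail_term_coef0 // mulSn; lia.
pose F i := fps_coef (tail_term j i) n.
rewrite -[LHS]/(\sum_(i < k) F i) -[RHS]/(\sum_(i < n.+1) F i).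
rewrite -!(big_mkord xpredT F) (big_cat_nat (leq0n _) ltnk) /=.
rewrite [X in _ + X]big_nat_cond [X in _ + X]big1 ?addr0 // => i.
by rewrite andbT => /andP[ltni _]; rewrite /F tail_term_coef0 // mulSn; lia.
Qed.
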